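(* There are arbitrarily large finite holey 3-hypertournaments $\mathbf B$ such that $\mathbf B$ has no completion but every proper (induced) substructure of $\mathbf B$ has a completion.
   Context: A 3-hypertournament is a structure $(A,R)$ with a single ternary relation $R$ such that for every 3-element set $S\subseteq A$ the automorphism group of the substructure induced on $S$ is exactly $\mathrm{Alt}(S)$; equivalently, on each 3-set $\{a,b,c\}$ exactly one of $(a,b,c),(a,c,b)$ is in $R$ and $R$ is closed under cyclic rotations. A structure is irreducible if every pair of its vertices lies in some tuple of some relation. A holey 3-hypertournament is a structure $(A,R)$ with one ternary relation such that every irreducible substructure is a 3-hypertournament; a hole is a 3-element set carrying no relation. $\mathbf H_4$ denotes the 3-hypertournament on 4 vertices whose automorphism group is $\mathrm{Alt}(4)$; a 3-hypertournament is $\mathbf H_4$-free if no substructure on 4 vertices is isomorphic to $\mathbf H_4$. A completion of a holey 3-hypertournament $(A,R)$ is a structure $(A,R')$ with $R\subseteq R'$ such that $(A,R')$ is an $\mathbf H_4$-free 3-hypertournament. *)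

(* Defs.v *)
From mathcomp Require Import all_boot all_fingroup.
From mathcomp Require Export alt.

Set Implicit Arguments.
Unset Strict Implicit.
Unset Printing Implicit Defensive.

Definition ternary (T : Type) := T -> T -> T -> bool.

Definition substructure (T : finType) (R : ternary T) (S : {set T}) :
    ternary {x : T | x \in S} :=
  fun x y z => R (val x) (val y) (val z).

Arguments substructure {T} R S _ _ _.

Definition isomorphic (T U : Type) (R : ternary T) (Q : ternary U) : Prop :=
  exists2 f : T -> U, bijective f &
    forall x y z, Q (f x) (f y) (f z) = R x y z.

Definition automorphisms (T : finType) (R : ternary T) : {set {perm T}} :=
  [set s : {perm T} |
    [forall x, forall y, forall z, R (s x) (s y) (s z) == R x y z]].

Definition nondegenerate (T : eqType) (R : ternary T) : Prop :=
  forall x y z, R x y z -> uniq [:: x; y; z].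

(* Without [nondegenerate], tuples with repeated entries such as             *)
(* (a,a,b), (b,b,c), (c,c,a) could alone produce the automorphism group      *)
(* Alt({a,b,c}), and the description in [hypertournamentP] would fail.       *)
Definition hypertournament (T : finType) (R : ternary T) : Prop :=
  nondegenerate R /\
  forall S : {set T}, #|S| = 3 ->
    automorphisms (substructure R S) = ('Alt_{x : T | x \in S})%g.

Definition irreducible (T : eqType) (R : ternary T) : Prop :=
  forall x y : T, x != y ->
    exists a b c : T,
      [/\ R a b c, x \in [:: a; b; c] & y \in [:: a; b; c]].

Definition holey_hypertournament (T : finType) (R : ternary T) : Prop :=
  forall S : {set T},
    irreducible (substructure R S) ->
    hypertournament (substructure R S).

(* The orbit of the triple (0, 1, 2) under Alt(4). That this is the          *)
(* 3-hypertournament on 4 vertices with automorphism group Alt(4), unique    *)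
(* up to isomorphism, is shown by [H4_hypertournament], [automorphisms_H4]   *)
(* and [H4_unique] below.                                                    *)
Definition H4 : ternary 'I_4 := fun i j k =>
  [exists s in ('Alt_'I_4)%g,
    [&& s (inord 0) == i, s (inord 1) == j & s (inord 2) == k]].

Definition H4_free (T : finType) (R : ternary T) : Prop :=
  forall S : {set T}, #|S| = 4 -> ~ isomorphic (substructure R S) H4.

Definition completion (T : finType) (R R' : ternary T) : Prop :=
  [/\ forall x y z, R x y z -> R' x y z, hypertournament R' & H4_free R'].

Definition has_completion (T : finType) (R : ternary T) : Prop :=
  exists R' : ternary T, completion R R'.

Import GroupScope.

Lemma automorphismsP (T : finType) (R : ternary T) (s : {perm T}) :
  reflect (forall x y z, R (s x) (s y) (s z) = R x y z)
          (s \in automorphisms R).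
Proof.
rewrite inE; apply: (iffP forallP) => [h x y z|h x].
  by have /forallP/(_ y)/forallP/(_ z)/eqP := h x.
by apply/forallP=> y; apply/forallP=> z; apply/eqP.
Qed.

Lemma hypertournamentP (T : finType) (R : ternary T) :
  hypertournament R <->
  [/\ nondegenerate R,
      forall x y z, uniq [:: x; y; z] -> R x y z (+) R x z y
    & forall x y z, R x y z -> R y z x].
Proof.
split=> [[ndR altR]|[ndR xorR rotR]].
  have rot x y z : R x y z -> R y z x.
    move=> Rxyz; have := ndR _ _ _ Rxyz.
    rewrite /= !inE negb_or => /and3P[/andP[nxy nxz] nyz _].
    pose S := [set x; y; z].
    have cS : #|S| = 3 by rewrite /S setUC cardsU1 cards2 !inE !(eq_sym z) negb_or nxz nyz nxy.
    have [Sx Sy Sz] : [/\ x \in S, y \in S & z \in S] by rewrite !inE !eqxx ?orbT.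
    pose a : {t | t \in S} := Sub x Sx; pose b : {t | t \in S} := Sub y Sy.
    pose c : {t | t \in S} := Sub z Sz.
    have nab : a != b by [].
    have nac : a != c by [].
    have nbc : b != c by [].
    pose s := tperm a b * tperm a c.
    have : s \in automorphisms (substructure R S).
      by rewrite altR // Alt_even odd_permM !odd_tperm nab nac.
    move=> /automorphismsP/(_ a b c); rewrite !permM tpermL tpermR.
    rewrite (tpermD nac nbc) tpermR tpermL.
    by rewrite tpermD // 1?eq_sym // /substructure /= => ->.
  split=> // x y z.
  rewrite /= !inE negb_or => /and3P[/andP[nxy nxz] nyz _].
  pose S := [set x; y; z].
  have cS : #|S| = 3 by rewrite /S setUC cardsU1 cards2 !inE !(eq_sym z) negb_or nxz nyz nxy.
  have [Sx Sy Sz] : [/\ x \in S, y \in S & z \in S] by rewrite !inE !eqxx ?orbT.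
  pose a : {t | t \in S} := Sub x Sx; pose b : {t | t \in S} := Sub y Sy.
  pose c : {t | t \in S} := Sub z Sz.
  have nab : a != b by [].
  have nac : a != c by [].
  have nbc : b != c by [].
  have rotE u v w : R u v w = R v w u.
    by apply/idP/idP=> [/rot //|/rot/rot].
  have : tperm b c \notin automorphisms (substructure R S).
    by rewrite altR // Alt_even odd_tperm nbc.
  have elt (t : {t | t \in S}) : [\/ t = a, t = b | t = c].
    have: val t \in S by exact: valP.
    rewrite /S !inE -orbA => /or3P[] /eqP tE; [apply: Or31|apply: Or32|apply: Or33];
      exact: val_inj.
  have nd1 u v : R u u v = false by apply/negP=> /ndR; rewrite /= !inE eqxx.
  have nd2 u v : R u v u = false by rewrite -rotE nd1.
  have nd3 u v : R v u u = false by rewrite rotE nd1.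
  apply: contraR; rewrite negb_add => /eqP eqR; apply/automorphismsP=> u v w.
  have ta : tperm b c a = a by rewrite tpermD // eq_sym.
  case: (elt u) (elt v) (elt w) => -> [] -> [] ->;
    rewrite /substructure ?ta ?tpermL ?tpermR /= ?nd1 ?nd2 ?nd3 //;
    first [exact: eqR | exact: esym eqR
          | by rewrite -rotE eqR rotE | by rewrite -rotE -eqR rotE
          | by rewrite rotE eqR -rotE | by rewrite rotE -eqR -rotE
          | by rewrite rotE eqR rotE | by rewrite rotE -eqR rotE
          | by rewrite -rotE eqR -rotE | by rewrite -rotE -eqR -rotE ].
split=> // S cS.
have rotE u v w : R u v w = R v w u.
  by apply/idP/idP=> [/rotR //|/rotR/rotR].
have nd1 u v : R u u v = false by apply/negP=> /ndR; rewrite /= !inE eqxx.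
have nd2 u v : R u v u = false by rewrite -rotE nd1.
have nd3 u v : R v u u = false by rewrite rotE nd1.
have : size (enum S) = 3 by rewrite -cardE.
have := enum_uniq (mem S); have := mem_enum (mem S).
case: (enum S) => [|x [|y [|z []]]] // memS uS _.
have xorS := xorR _ _ _ uS; move: uS.
rewrite /= !inE negb_or => /and3P[/andP[nxy nxz] nyz _].
have [Sx Sy Sz] : [/\ x \in S, y \in S & z \in S].
  by rewrite -!memS !inE !eqxx ?orbT.
pose a : {t | t \in S} := Sub x Sx; pose b : {t | t \in S} := Sub y Sy.
pose c : {t | t \in S} := Sub z Sz.
have nab : a != b by [].
have nac : a != c by [].
have nbc : b != c by [].
have elt (t : {t | t \in S}) : [\/ t = a, t = b | t = c].
  have: val t \in S by exact: valP.
  rewrite -memS !inE => /or3P[] /eqP tE; [apply: Or31|apply: Or32|apply: Or33];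
    exact: val_inj.
have [nba nca ncb] : [/\ b != a, c != a & c != b] by rewrite !(eq_sym c) (eq_sym b).
have eqp (s t : {perm {t | t \in S}}) :
    s a = t a -> s b = t b -> s c = t c -> s = t.
  by move=> sa sb sc; apply/permP=> u; case: (elt u) => ->.
have autS (s : {perm {t | t \in S}}) :
  (s \in automorphisms (substructure R S)) =
  (R (val (s a)) (val (s b)) (val (s c)) == R x y z) &&
  (R (val (s a)) (val (s c)) (val (s b)) == R x z y).
  apply/automorphismsP/andP=> [h|[/eqP h1 /eqP h2] u v w].
    by split; apply/eqP; [exact: (h a b c)|exact: (h a c b)].
  by case: (elt u) (elt v) (elt w) => -> [] -> [] ->;
    rewrite /substructure ?nd1 ?nd2 ?nd3 //=;
    first [exact: h1 | exact: h2 | rewrite !(rotE y); first [exact: h1|exact: h2]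
     | rewrite rotE h1 -rotE | rewrite rotE h2 -rotE
     | rewrite -rotE h1 rotE | rewrite -rotE h2 rotE].
apply/setP=> s; rewrite autS Alt_even.
have injs u v : u != v -> s u != s v by rewrite (inj_eq perm_inj).
have := injs _ _ nab; have := injs _ _ nac; have := injs _ _ nbc.
have ta : tperm b c a = a by rewrite tpermD.
have tb : tperm a c b = b by rewrite tpermD.
have tc : tperm a b c = c by rewrite tpermD.
case: (elt (s a)) (elt (s b)) (elt (s c)) => sa [] sb [] sc;
  rewrite sa sb sc ?eqxx //= => _ _ _.
- have -> : s = 1 by apply: eqp; rewrite ?permE.
  by rewrite odd_perm1.
- have -> : s = tperm b c by apply: eqp; rewrite ?ta ?tpermL ?tpermR.
  by rewrite odd_tperm nbc /=; case: (R x y z) (R x z y) xorS => [] [].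
- have -> : s = tperm a b by apply: eqp; rewrite ?tc ?tpermL ?tpermR.
  rewrite odd_tperm nab /= (rotE y x z) (rotE y z x) (rotE z x y).
  by case: (R x y z) (R x z y) xorS => [] [].
- have -> : s = tperm b c * tperm a b.
    by apply: eqp; rewrite permM ?(ta,tb,tc,tpermL,tpermR).
  rewrite odd_permM !odd_tperm nab nbc /= -(rotE x y z) (rotE y x z).
  by rewrite !eqxx.
- have -> : s = tperm a b * tperm b c.
    by apply: eqp; rewrite permM ?(ta,tb,tc,tpermL,tpermR).
  rewrite odd_permM !odd_tperm nab nbc /= (rotE z x y) -(rotE x z y).
  by rewrite !eqxx.
- have -> : s = tperm a c by apply: eqp; rewrite ?tb ?tpermL ?tpermR.
  rewrite odd_tperm nac /= -(rotE x z y) (rotE z x y).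
  by case: (R x y z) (R x z y) xorS => [] [].
Qed.

Lemma H4P (i j k : 'I_4) :
  reflect (exists s : {perm 'I_4}, [/\ ~~ odd_perm s, s (inord 0) = i,
             s (inord 1) = j & s (inord 2) = k])
          (H4 i j k).
Proof.
apply: (iffP existsP) => [[s /and4P[]]|[s [es si sj sk]]].
  by rewrite Alt_even => es /eqP si /eqP sj /eqP sk; exists s.
by exists s; rewrite Alt_even es si sj sk !eqxx.
Qed.

Lemma ord4_ind (P : 'I_4 -> Prop) :
  P (inord 0) -> P (inord 1) -> P (inord 2) -> P (inord 3) -> forall i, P i.
Proof.
move=> P0 P1 P2 P3 i; rewrite -(inord_val i).
by case: i => [[|[|[|[|]]]]].
Qed.

Lemma inord4_eq m n : m < 4 -> n < 4 ->
  (inord m == inord n :> 'I_4) = (m == n).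
Proof. by move=> hm hn; rewrite -val_eqE /= !inordK. Qed.

Lemma perm4_ext (s t : {perm 'I_4}) :
  s (inord 0) = t (inord 0) -> s (inord 1) = t (inord 1) ->
  s (inord 2) = t (inord 2) -> s = t.
Proof.
move=> e0 e1 e2; suff e3 : s (inord 3) = t (inord 3).
  by apply/permP; apply: ord4_ind.
have := permKV t (s (inord 3)); move: (t^-1 _).
apply: ord4_ind => // e; [move: e0|move: e1|move: e2]; rewrite e => /perm_inj/eqP;
  by rewrite inord4_eq.
Qed.

Lemma perm4_exists (i j k : 'I_4) : uniq [:: i; j; k] ->
  exists s : {perm 'I_4},
    [/\ s (inord 0) = i, s (inord 1) = j & s (inord 2) = k].
Proof.
rewrite /= !inE negb_or => /and3P[/andP[nij nik] njk _].
pose s1 := tperm (inord 0) i.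
pose s2 := s1 * tperm (s1 (inord 1)) j.
have s20 : s2 (inord 0) = i.
  rewrite permM tpermL tpermD // 1?eq_sym //.
  by rewrite -[i in i != _](tpermL (inord 0) i) (inj_eq perm_inj) inord4_eq.
have s21 : s2 (inord 1) = j by rewrite permM tpermL.
have n2i : s2 (inord 2) != i by rewrite -s20 (inj_eq perm_inj) inord4_eq.
have n2j : s2 (inord 2) != j by rewrite -s21 (inj_eq perm_inj) inord4_eq.
exists (s2 * tperm (s2 (inord 2)) k); split; rewrite permM ?tpermL // ?s20 ?s21.
  by rewrite tpermD // eq_sym.
by rewrite tpermD // eq_sym.
Qed.

Lemma H4_hypertournament : hypertournament H4.
Proof.
have n01 : inord 0 != inord 1 :> 'I_4 by rewrite inord4_eq.
have n02 : inord 0 != inord 2 :> 'I_4 by rewrite inord4_eq.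
have n12 : inord 1 != inord 2 :> 'I_4 by rewrite inord4_eq.
apply/hypertournamentP; split.
- move=> i j k /H4P[s [_ <- <- <-]].
  by rewrite /= !inE !(inj_eq perm_inj) (negPf n01) (negPf n02) n12.
- move=> i j k /perm4_exists[s [s0 s1 s2]].
  have t0 : tperm (inord 1) (inord 2) (inord 0 : 'I_4) = inord 0.
    by rewrite tpermD // eq_sym.
  have -> : H4 i j k = ~~ odd_perm s.
    apply/H4P/idP=> [[t [et t0' t1 t2]]|es]; last by exists s.
    by rewrite (_ : s = t) //; apply: perm4_ext; congruence.
  have -> : H4 i k j = odd_perm s.
    apply/H4P/idP=> [[t [et t0' t1 t2]]|os].
      have -> : s = tperm (inord 1) (inord 2) * t.
        by apply: perm4_ext; rewrite permM ?(t0, tpermL, tpermR); congruence.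
      by rewrite odd_permM odd_tperm n12 addTb.
    exists (tperm (inord 1) (inord 2) * s).
    by rewrite odd_permM odd_tperm n12 os !permM ?(t0, tpermL, tpermR).
  by case: odd_perm.
- move=> i j k /H4P[s [es s0 s1 s2]]; apply/H4P.
  exists (tperm (inord 0) (inord 1) * tperm (inord 0) (inord 2) * s).
  rewrite !odd_permM !odd_tperm n01 n02 es !permM ?tpermL ?tpermR.
  by rewrite ?(tpermD n02 n12) ?tpermR ?tpermL tpermD // 1?eq_sym.
Qed.

Lemma automorphisms_H4 : automorphisms H4 = 'Alt_'I_4.
Proof.
have even_H4 (t : {perm 'I_4}) i j k :
    ~~ odd_perm t -> H4 i j k -> H4 (t i) (t j) (t k).
  move=> et /H4P[s [es <- <- <-]]; apply/H4P; exists (s * t).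
  by rewrite odd_permM (negPf es) (negPf et) !permM.
apply/setP=> t; rewrite Alt_even; apply/automorphismsP/idP=> [aut|et i j k].
  have : H4 (inord 0) (inord 1) (inord 2).
    by apply/H4P; exists 1; rewrite odd_perm1 !perm1.
  by rewrite -aut => /H4P[s [es s0 s1 s2]]; rewrite -(perm4_ext s0 s1 s2).
apply/idP/idP; last exact: even_H4.
by move=> /(even_H4 t^-1); rewrite odd_permV !permK; apply.
Qed.

Lemma H4_unique (R : ternary 'I_4) :
  hypertournament R -> automorphisms R = 'Alt_'I_4 -> isomorphic H4 R.
Proof.
move=> htR autR.
have [ndR xorR rotR] := (hypertournamentP R).1 htR.
have [ndH xorH rotH] := (hypertournamentP H4).1 H4_hypertournament.
have evenR (t : {perm 'I_4}) i j k :
    ~~ odd_perm t -> R (t i) (t j) (t k) = R i j k.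
  by rewrite -Alt_even -autR => /automorphismsP.
have [f Rf] : exists f : {perm 'I_4},
    R (f (inord 0)) (f (inord 1)) (f (inord 2)).
  have n12 : inord 1 != inord 2 :> 'I_4 by rewrite inord4_eq.
  have u : uniq [:: inord 0; inord 1; inord 2 : 'I_4].
    by rewrite /= !inE !inord4_eq.
  have := xorR _ _ _ u; case Re: (R _ _ _) => /= h.
    by exists 1; rewrite !perm1.
  exists (tperm (inord 1) (inord 2)).
  by rewrite tpermL tpermR tpermD // eq_sym inord4_eq.
have sub i j k : H4 i j k -> R (f i) (f j) (f k).
  move=> /H4P[s [es <- <- <-]].
  have <- : R ((s ^ f) (f (inord 0))) ((s ^ f) (f (inord 1)))
              ((s ^ f) (f (inord 2))) = R (f (s (inord 0))) (f (s (inord 1)))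
              (f (s (inord 2))) by rewrite !permJ.
  by rewrite evenR // odd_permJ.
exists f => [|i j k]; first by exists (f^-1) => x; rewrite ?permK ?permKV.
apply/idP/idP; last exact: sub.
move=> Rijk; have := ndR _ _ _ Rijk => uf.
have u : uniq [:: i; j; k].
  by rewrite -(map_inj_uniq (@perm_inj _ f)).
have := xorH _ _ _ u; case: (H4 i j k) => //= /sub Rikj.
by have := xorR _ _ _ uf; rewrite Rijk Rikj.
Qed.

(* Main.v *)
Require Import Defs.
From mathcomp Require Import all_boot all_fingroup zify.
From Stdlib Require Import Classical.

(* Some 4-sets act as implications: if (p,q,a) and (q,p,b) are given, then     *)
(* avoiding H4 on {a,b,p,q} means that (a,b,p) implies (a,b,q). Joining two    *)
(* vertices by a path whose consecutive pairs carry such triples transports    *)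
(* an implication over any distance. Take vertices 0, 1, 2 and c, and for      *)
(* every t in {0,1,2} join the other two vertices of the triangle by such      *)
(* paths in both directions, with a = t and b = c. Say that s beats t when     *)
(* (t,c,s) holds: this is a tournament on {0,1,2}, and in a completion the     *)
(* paths force every t to be beaten by both other vertices or by neither,      *)
(* which is absurd.                                                            *)
(*   A small substructure misses an inner vertex of every path. It can then be *)
(* dismantled by repeatedly removing a vertex v all of whose triples contain   *)
(* a common vertex u, and in the reverse order each v is put back as a twin    *)
(* of u. So every minimal non-completable substructure is large.               *)

(** In a hypertournament, copies of [H4] are exactly the [coherent] quadruples
    ([incoherent_H4_free], [H4_free_incoherent]). The structure [chains n] realises the cycle of
    implications above: [completion_path] transports them, and [chains_incompletable] derives the
    contradiction. Every triple contains an inner vertex, and inner vertices belong to a single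
    path; this pins an irreducible substructure to one path and makes it a hypertournament
    ([chains_irreducible]). Sets of at most n vertices can be peeled ([chains_peelable]) and rebuilt
    by twins ([twin_extension], [peelable_completion]). A non-completable substructure of least size
    ([minimal_incompletable]) therefore has more than n vertices; being induced in [chains n], it is
    holey, and it serves as B. *)

Set Implicit Arguments.
Unset Strict Implicit.
Unset Printing Implicit Defensive.

(** * Coherent quadruples *)

(* The four triples induce opposite directions on every common pair, as the  *)
(* faces of an oriented tetrahedron do.                                       *)
Definition coherent (T : Type) (R : ternary T) (a b c d : T) :=
  [&& R a b c, R a c d, R a d b & R b d c].

Definition partial_hypertournament (T : eqType) (R : ternary T) : Prop :=
  [/\ nondegenerate R, forall x y z, R x y z = R y z x
    & forall x y z, R x y z -> ~~ R x z y].

Lemma hypertournament_xor (T : finType) (R : ternary T) x y z :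
  hypertournament R -> uniq [:: x; y; z] -> R x z y = ~~ R x y z.
Proof.
move=> /hypertournamentP[_ xor _] /xor.
by case: (R x y z); case: (R x z y).
Qed.

Lemma hypertournament_partial (T : finType) (R : ternary T) :
  hypertournament R -> partial_hypertournament R.
Proof.
move=> htR; have [nd _ rot] := (hypertournamentP R).1 htR.
split=> // x y z; first by apply/idP/idP=> [/rot | /rot/rot].
by move=> Rxyz; rewrite (hypertournament_xor htR) ?Rxyz //; apply: nd.
Qed.

Lemma partial_hypertournament_total (T : finType) (R : ternary T) :
  partial_hypertournament R ->
  (forall x y z, uniq [:: x; y; z] -> R x y z || R x z y) ->
  hypertournament R.
Proof.
move=> [nd rot asym] tot; apply/hypertournamentP; split=> // x y z.
  move=> /tot; have := asym x y z.
  by case: (R x y z) => [/(_ isT)/negPf->|_ /= ->].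
by rewrite rot.
Qed.

(** Together with [coherent_swap] this generates the action of Alt(4), so any of the four vertices
    can be brought to the front. *)
Lemma coherent_rot (T : eqType) (R : ternary T) a b c d :
  partial_hypertournament R -> coherent R a b c d = coherent R a c d b.
Proof.
move=> [_ rot _]; rewrite /coherent -(rot c b d).
by case: (R a b c); case: (R a c d); rewrite /= ?andbT ?andbF.
Qed.

Lemma coherent_swap (T : eqType) (R : ternary T) a b c d :
  partial_hypertournament R -> coherent R a b c d -> coherent R b a d c.
Proof.
move=> [_ rot _] /and4P[abc acd adb bdc]; rewrite /coherent bdc acd.
by rewrite rot adb -rot abc.
Qed.

Lemma coherent_uniq (T : eqType) (R : ternary T) a b c d :
  nondegenerate R -> coherent R a b c d -> uniq [:: a; b; c; d].
Proof.
move=> nd /and4P[/nd + /nd + /nd + /nd]; rewrite /= !inE !negb_or.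
move=> /and3P[/andP[-> ->] -> _] /and3P[/andP[_ ->] -> _] _.
by move=> /and3P[/andP[-> _] _ _].
Qed.

Lemma coherent_H4 : coherent H4 (inord 0) (inord 1) (inord 2) (inord 3).
Proof.
have [_ rot _] := hypertournament_partial H4_hypertournament.
have H012 : H4 (inord 0) (inord 1) (inord 2).
  by apply/H4P; exists 1%g; rewrite odd_perm1 !perm1.
(* The 3-cycle on i, j, k is an even permutation fixing l, hence an automorphism. *)
have cyc i j k l : uniq [:: i; j; k; l] -> H4 l i j -> H4 l j k.
  rewrite /= !inE !negb_or => /and4P[/and3P[nij nik nil] /andP[njk njl] nkl _].
  pose s : {perm 'I_4} := (tperm i j * tperm i k)%g.
  have : s \in automorphisms H4.
    by rewrite automorphisms_H4 Alt_even odd_permM !odd_tperm nij nik.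
  move=> /automorphismsP <-; rewrite !permM tpermL tpermR tpermL.
  by rewrite (tpermD nil njl) (tpermD nil nkl) tpermD // eq_sym.
have uniq4 m n p q : uniq [:: m; n; p; q] -> all (ltn^~ 4) [:: m; n; p; q] ->
    uniq [:: inord m; inord n; inord p; inord q : 'I_4].
  by move=> + /and5P[? ? ? ? _]; rewrite /= !inE !inord4_eq.
have H023 := cyc _ _ _ _ (uniq4 1 2 3 0 isT isT) H012.
have H031 := cyc _ _ _ _ (uniq4 2 3 1 0 isT isT) H023.
rewrite /coherent H012 H023 H031 -rot; apply: cyc (uniq4 0 1 3 2 isT isT) _.
by rewrite rot.
Qed.

(** Coherence directs one triple on each of the four 3-subsets; rotation and asymmetry give the
    rest. *)
Lemma coherent_eq (Q Q' : ternary 'I_4) :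
  hypertournament Q -> hypertournament Q' ->
  coherent Q (inord 0) (inord 1) (inord 2) (inord 3) ->
  coherent Q' (inord 0) (inord 1) (inord 2) (inord 3) ->
  forall i j k, Q i j k = Q' i j k.
Proof.
move=> htQ htQ' cQ cQ'.
have [ndQ rotQ asymQ] := hypertournament_partial htQ.
have [ndQ' rotQ' asymQ'] := hypertournament_partial htQ'.
have eq_nd i j k : ~~ uniq [:: i; j; k] -> Q i j k = Q' i j k.
  move=> nu; transitivity false; last apply/esym.
    by apply: contraNF nu; apply: ndQ.
  by apply: contraNF nu; apply: ndQ'.
have eq_rot i j k : Q i j k = Q' i j k -> Q j k i = Q' j k i.
  by rewrite rotQ rotQ'.
have eq_rotr i j k : Q i j k = Q' i j k -> Q k i j = Q' k i j.
  by rewrite -rotQ -rotQ'.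
have eq_asym i j k : Q i j k && Q' i j k -> Q i k j = Q' i k j.
  by move=> /andP[/asymQ/negPf-> /asymQ'/negPf->].
move: cQ cQ' => /and4P[q1 q2 q3 q4] /and4P[q1' q2' q3' q4'].
have eq_even i j k : Q i j k && Q' i j k -> Q i j k = Q' i j k.
  by move=> /andP[-> ->].
by apply: ord4_ind; apply: ord4_ind; apply: ord4_ind;
  first [by apply: eq_nd; rewrite /= !inE !inord4_eq
  | by apply: eq_even; apply/andP
  | by apply: eq_asym; apply/andP
  | by apply: eq_rot; apply: eq_even; apply/andP
  | by apply: eq_rot; apply: eq_asym; apply/andP
  | by apply: eq_rotr; apply: eq_even; apply/andP
  | by apply: eq_rotr; apply: eq_asym; apply/andP].
Qed.

(** * Building hypertournaments without coherent quadruples *)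

(** In the cyclic order induced by a linear order, (a,b,c) and (a,c,d) give (a,b,d), which excludes
    (a,d,b). *)
Lemma linear_hypertournament (T : finType) :
  exists2 R : ternary T, hypertournament R & forall a b c d, ~~ coherent R a b c d.
Proof.
pose r (x : T) : nat := enum_rank x.
have rI : injective r by move=> x y /val_inj/enum_rank_inj.
pose R : ternary T := fun x y z =>
  [|| r x < r y < r z, r y < r z < r x | r z < r x < r y].
exists R.
  apply/hypertournamentP; split=> x y z.
  - by rewrite /R /= !inE -!(inj_eq rI); lia.
  - by rewrite /R /= !inE -!(inj_eq rI); lia.
  - by rewrite /R; lia.
by move=> a b c d; rewrite /coherent /R; lia.
Qed.

(** The vertex v copies u, except that triples containing both are directed freely, as [R] demands.
    A coherent quadruple containing both twins is impossible: its two faces on the other pair would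
    direct that pair oppositely, while twins direct it alike. Any other one maps injectively to a
    coherent quadruple of [R']. *)
Lemma twin_extension (T : finType) (R R' : ternary T) (S : {set T}) (u v : T) :
  partial_hypertournament R -> hypertournament R' ->
  (forall a b c d, ~~ coherent R' a b c d) -> u != v ->
  (forall x y z, x \in S :\ v -> y \in S :\ v -> z \in S :\ v ->
     R x y z -> R' x y z) ->
  (forall x y, x \in S -> y \in S -> R v x y -> (x == u) || (y == u)) ->
  exists R'' : ternary T,
    [/\ hypertournament R'', forall a b c d, ~~ coherent R'' a b c d
      & forall x y z, x \in S -> y \in S -> z \in S -> R x y z -> R'' x y z].
Proof.
move=> [ndR rotR asymR] htR' freeR' neq_uv extR' dom.
have [ndR' rotR' asymR'] := hypertournament_partial htR'.
pose s x := if x == v then u else x.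
(* The triple on u, v, w follows [R] where [R] directs it, and defaults to (u,v,w) on a hole. *)
pose J x y w := [&& w != u, w != v &
  if R v u w then (x == v) && (y == u) else (x == u) && (y == v)].
pose R2 : ternary T := fun x y z =>
  [|| R' (s x) (s y) (s z), J x y z, J y z x | J z x y].
have sv : s v = u by rewrite /s eqxx.
have sN x : x != v -> s x = x by rewrite /s => /negPf->.
have rotR2 x y z : R2 x y z = R2 y z x.
  by rewrite /R2 (rotR' (s x)); do 3 case: (J _ _ _); rewrite ?orbT.
have R2N x y z : x != v -> y != v -> z != v -> R2 x y z = R' x y z.
  move=> xv yv zv; rewrite /R2 !sN // /J (negPf xv) (negPf yv) (negPf zv).
  by rewrite !(andbF, if_same, orbF).
have R2v y z : uniq [:: u; v; y; z] -> R2 v y z = R' u y z.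
  rewrite /= !inE !negb_or => /and4P[/and3P[_ uy uz] /andP[vy vz] yz _].
  rewrite /R2 sv !sN 1?eq_sym // /J eqxx /= (eq_sym y u) (eq_sym z u).
  rewrite (eq_sym z v) (eq_sym y v).
  rewrite (negPf uy) (negPf uz) (negPf vy) (negPf vz).
  by rewrite !(andbF, if_same, orbF).
have R'uu w : R' u u w = false.
  by apply/negP=> /ndR'; rewrite /= !inE eqxx.
have R2vu w : uniq [:: u; v; w] -> R2 v u w = R v u w.
  rewrite /= !inE negb_or => /and3P[/andP[uv uw] vw _].
  rewrite /R2 sv (sN u) // R'uu /= /J.
  rewrite !eqxx (eq_sym w) uw (eq_sym w) vw (eq_sym v) (negPf uv) /= orbF.
  by case: (R v u w).
have R2uv w : uniq [:: u; v; w] -> R2 u v w = ~~ R v u w.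
  rewrite /= !inE negb_or => /and3P[/andP[uv uw] vw _].
  rewrite /R2 sv (sN u) // R'uu /= /J.
  rewrite !eqxx (eq_sym w) uw (eq_sym w) vw (eq_sym v) (negPf uv) /= orbF.
  by case: (R v u w).
have ndR2 : nondegenerate R2.
  have ndJ x y w : J x y w -> uniq [:: x; y; w].
    rewrite /J => /and3P[wu wv]; case: ifP => _ /andP[/eqP-> /eqP->] /=;
      by rewrite !inE !negb_or !(eq_sym _ w) wu wv ?andbT // eq_sym.
  move=> x y z /or4P[/ndR'|/ndJ //|/ndJ|/ndJ].
  - exact: (@map_uniq _ _ s [:: x; y; z]).
  - by rewrite -(rot_uniq 2).
  - by rewrite -(rot_uniq 1).
have sep y z : uniq [:: v; y; z] -> y != u -> z != u -> uniq [:: u; v; y; z].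
  by move=> uvyz yu zu; rewrite cons_uniq uvyz !inE !negb_or neq_uv !(eq_sym u) yu zu.
have xorv y z : uniq [:: v; y; z] -> R2 v z y = ~~ R2 v y z.
  have uniqC a b : uniq [:: v; a; b] -> uniq [:: v; b; a].
    by rewrite /= !inE !negb_or (eq_sym b) => /and3P[/andP[-> ->] ->].
  move=> uvyz; have uvzy := uniqC _ _ uvyz.
  have [yu|yu] := eqVneq y u.
    move: uvzy; rewrite {y}yu in uvyz *; rewrite -(rot_uniq 2) => uuvz.
    by rewrite -rotR2 R2uv // R2vu.
  have [zu|zu] := eqVneq z u.
    move: uvyz; rewrite {z}zu in uvzy *; rewrite -(rot_uniq 2) => uuvy.
    by rewrite -(rotR2 u) R2uv // R2vu // negbK.
  rewrite !R2v ?sep // (hypertournament_xor htR') //.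
  move: (sep _ _ uvyz yu zu); rewrite /= !inE !negb_or.
  by move=> /and4P[/and3P[_ -> ->] _ -> _].
have htR2 : hypertournament R2.
  apply/hypertournamentP; split=> // [x y z uxyz|x y z]; last by rewrite rotR2.
  suff -> : R2 x z y = ~~ R2 x y z by case: (R2 x y z).
  have [xv|xv] := eqVneq x v; first by rewrite {x}xv in uxyz *; apply: xorv.
  have [yv|yv] := eqVneq y v.
    rewrite {y}yv in uxyz *; rewrite -(rotR2 v) (rotR2 x v); apply: xorv.
    by rewrite -(rot_uniq 2).
  have [zv|zv] := eqVneq z v.
    rewrite {z}zv in uxyz *; rewrite rotR2 -(rotR2 v x); apply: xorv.
    by rewrite -(rot_uniq 1).
  by rewrite !R2N // (hypertournament_xor htR').
have phR2 := hypertournament_partial htR2.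
have freeR2vu c d : ~~ coherent R2 v u c d.
  apply/negP=> coh; have := coherent_uniq ndR2 coh.
  rewrite -[uniq _]/(uniq ([:: v] ++ [:: u] ++ [:: c; d])) uniq_catCA => uvcd.
  have /and4P[_ + _ +] := coh; rewrite R2v // => ucd.
  have /and4P[/norP[_ _] + _ _] := uvcd; rewrite !inE !negb_or => /andP[vc vd].
  by rewrite R2N ?(eq_sym c) ?(eq_sym d) // (negPf (asymR' _ _ _ ucd)).
have freeR2v b c d : ~~ coherent R2 v b c d.
  have [->|bu] := eqVneq b u; first exact: freeR2vu.
  have [->|cu] := eqVneq c u; first by rewrite coherent_rot.
  have [->|du] := eqVneq d u; first by rewrite 2?coherent_rot.
  apply/negP=> coh; have := coherent_uniq ndR2 coh.
  rewrite /= !inE !negb_or => /and4P[/and3P[vb vc vd] /andP[bc bd] cd _].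
  have db : d != b by rewrite eq_sym.
  have /negP := freeR' u b c d; apply; move: coh.
  rewrite /coherent (R2N b) ?(eq_sym _ v) // !R2v //;
    by apply: sep => //=; rewrite !inE negb_or ?vb ?vc ?vd ?bc ?cd ?db.
exists R2; split=> // [a b c d|x y z Sx Sy Sz Rxyz].
  apply/negP=> coh; have /negP := freeR' a b c d; apply.
  have [av|av] := eqVneq a v; first by rewrite av (negPf (freeR2v _ _ _)) in coh.
  have [bv|bv] := eqVneq b v.
    by move: coh; rewrite bv => /(coherent_swap phR2); rewrite (negPf (freeR2v _ _ _)).
  have [cv|cv] := eqVneq c v.
    move: coh; rewrite cv coherent_rot // => /(coherent_swap phR2).
    by rewrite (negPf (freeR2v _ _ _)).
  have [dv|dv] := eqVneq d v.
    move: coh; rewrite dv 2?coherent_rot // => /(coherent_swap phR2).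
    by rewrite (negPf (freeR2v _ _ _)).
  by move: coh; rewrite /coherent !R2N.
have extv y' z' : y' \in S -> z' \in S -> R v y' z' -> R2 v y' z'.
  move=> Sy' Sz' Rv; have := ndR _ _ _ Rv.
  case/orP: (dom _ _ Sy' Sz' Rv) => /eqP eu; rewrite {}eu in Rv *.
    rewrite /= !inE !negb_or => /and3P[/andP[_ vz] uz _].
    by rewrite R2vu //= !inE negb_or neq_uv uz vz.
  rewrite -(rot_uniq 2) => uuv.
  by rewrite -rotR2 R2uv // rotR asymR // rotR.
have [xv|xv] := eqVneq x v; first by rewrite xv in Rxyz *; apply: extv.
have [yv|yv] := eqVneq y v.
  by rewrite yv rotR rotR2 in Rxyz *; apply: extv.
have [zv|zv] := eqVneq z v.
  by rewrite zv -rotR -rotR2 in Rxyz *; apply: extv.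
by rewrite R2N // extR' // !inE ?xv ?yv ?zv.
Qed.

(** * Coherence versus copies of H4, and completion by peeling *)

Lemma hypertournament_pullback (T U : finType) (R : ternary T) (f : U -> T) :
  injective f -> hypertournament R ->
  hypertournament (fun x y z => R (f x) (f y) (f z)).
Proof.
move=> fI /hypertournamentP[nd xor rot]; apply/hypertournamentP.
have uniqf x y z : uniq [:: f x; f y; f z] = uniq [:: x; y; z].
  exact: (map_inj_uniq fI [:: x; y; z]).
split=> [x y z /nd|x y z|x y z /rot //]; first by rewrite uniqf.
by rewrite -uniqf; apply: xor.
Qed.

Lemma incoherent_H4_free (T : finType) (R : ternary T) :
  (forall a b c d, ~~ coherent R a b c d) -> H4_free R.
Proof.
move=> free S _ [f [g _ gK] Hf].
have Rg i j k : R (val (g i)) (val (g j)) (val (g k)) = H4 i j k.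
  by rewrite -{2}(gK i) -{2}(gK j) -{2}(gK k) Hf.
have /negP := free (val (g (inord 0))) (val (g (inord 1)))
                   (val (g (inord 2))) (val (g (inord 3))); apply.
by rewrite /coherent !Rg; apply: coherent_H4.
Qed.

Lemma H4_free_incoherent (T : finType) (R : ternary T) a b c d :
  hypertournament R -> H4_free R -> ~~ coherent R a b c d.
Proof.
move=> htR freeR; apply/negP=> coh.
have uabcd : uniq [:: a; b; c; d].
  by apply: coherent_uniq coh; have [] := hypertournament_partial htR.
pose h (i : 'I_4) := nth a [:: a; b; c; d] i.
have hI : injective h.
  by move=> i j /eqP; rewrite nth_uniq // => /eqP/val_inj.
pose S := [set h i | i in 'I_4].
have cS : #|S| = 4 by rewrite card_imset // card_ord.
have hS i : h i \in S by apply: imset_f.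
pose g i : {x | x \in S} := exist _ (h i) (hS i).
have gI : injective g by move=> i j /(congr1 val)/hI.
have [|f fK gK] := inj_card_bij gI; first by rewrite card_sig cS card_ord.
apply: (freeR S cS); exists f; first by exists g.
move=> x y z.
rewrite -{2}(gK x) -{2}(gK y) -{2}(gK z) /substructure /=.
have cohh : coherent (fun i j k => R (h i) (h j) (h k))
    (inord 0) (inord 1) (inord 2) (inord 3) by rewrite /coherent /h !inordK.
exact/esym/(coherent_eq (hypertournament_pullback hI htR)
              H4_hypertournament cohh coherent_H4).
Qed.

Lemma completion_pullback (T U : finType) (R : ternary T) (f : U -> T) :
  injective f -> has_completion R ->
  has_completion (fun x y z => R (f x) (f y) (f z)).
Proof.
move=> fI [R' [RR' htR' freeR']].
exists (fun x y z => R' (f x) (f y) (f z)); split=> [x y z /RR' //||].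
  exact: hypertournament_pullback.
apply: incoherent_H4_free => a b c d.
exact: (H4_free_incoherent (f a) (f b) (f c) (f d) htR' freeR').
Qed.

(* Vertices are put back one at a time, each as a twin of the vertex [u]     *)
(* shared by all its triples; pairs of twins never create a copy of H4.      *)
Lemma peelable_completion (T : finType) (R : ternary T) (S : {set T}) :
  partial_hypertournament R ->
  (forall A : {set T}, A \subset S -> A != set0 ->
     exists u v, [/\ v \in A, u != v &
       forall x y, x \in A -> y \in A -> R v x y -> (x == u) || (y == u)]) ->
  has_completion (substructure R S).
Proof.
move=> phR peel.
have [R' [htR' freeR' extR']] : exists R' : ternary T,
    [/\ hypertournament R', forall a b c d, ~~ coherent R' a b c d
      & forall x y z, x \in S -> y \in S -> z \in S -> R x y z -> R' x y z].
  have: S \subset S by []; move: {1 3 4 5}S => A.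
  have [n] := ubnP #|A|; elim: n A => // n IHn A cA AS.
  have [A0|A0] := eqVneq A set0.
    have [R' htR' freeR'] := linear_hypertournament T.
    by exists R'; split=> // x y z; rewrite A0 inE.
  have [u [v [Av uv dom]]] := peel A AS A0.
  have [||R' [htR' freeR' extR']] := IHn (A :\ v).
  - by rewrite (cardsD1 v) Av in cA.
  - exact: subset_trans (subsetDl _ _) AS.
  exact: twin_extension extR' dom.
exists (substructure R' S); split=> [x y z||].
- by apply: extR'; apply: valP.
- exact: hypertournament_pullback val_inj htR'.
- by apply: incoherent_H4_free => a b c d; apply: freeR'.
Qed.

(** * The structure of paths *)

(* [inl (Some t)] are the vertices of the triangle, [inl None] is the vertex *)
(* c, and [inr (k, i)] is the i-th inner vertex of the path k.               *)
Definition vertex (n : nat) : finType :=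
  (option 'I_3 + ('I_3 * bool) * 'I_n.+1)%type.

(** The path k joins the two triangle vertices other than [k.1]; the boolean selects the direction,
    and each direction has its own inner vertices. *)
Definition source (k : 'I_3 * bool) : 'I_3 :=
  if k.2 then ordS k.1 else ord_pred k.1.

Definition target (k : 'I_3 * bool) : 'I_3 :=
  if k.2 then ord_pred k.1 else ordS k.1.

(* The position of a vertex on the path k; the value [n.+4] for vertices off *)
(* the path is not adjacent to any position on it.                           *)
Definition pos (n : nat) (k : 'I_3 * bool) (x : vertex n) : nat :=
  match x with
  | inr p => if p.1 == k then p.2.+1 else n.+4
  | inl (Some t) =>
      if t == source k then 0 else if t == target k then n.+2 else n.+4
  | inl None => n.+4
  end.

(** Inverse of [pos] on the positions 0 to n + 2; inner vertices occupy 1 to n + 1, whence the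
    shifted index. *)
Definition node (n : nat) (k : 'I_3 * bool) (i : nat) : vertex n :=
  if i == 0 then inl (Some (source k))
  else if i == n.+2 then inl (Some (target k))
  else inr (k, inord i.-1).

Definition step (n : nat) k (x y : vertex n) := pos k y == (pos k x).+1.

Definition apex (n : nat) (k : 'I_3 * bool) (b : bool) : vertex n :=
  inl (if b then Some k.1 else None).

(** A step from p to q carries (p,q,a) and (q,p,c), with a the triangle vertex [k.1]: the two
    triples that turn {a,c,p,q} into an implication. *)
Definition wing (n : nat) k (x y z : vertex n) :=
  step k x y && (z == apex n k true) || step k y x && (z == apex n k false).

Definition path_triple (n : nat) k (x y z : vertex n) :=
  [|| wing k x y z, wing k y z x | wing k z x y].

Definition chains (n : nat) : ternary (vertex n) :=
  fun x y z => [exists k, path_triple k x y z].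

Definition owner (n : nat) (x : vertex n) : option ('I_3 * bool) :=
  if x is inr p then Some p.1 else None.

Lemma triangle_neq (k : 'I_3 * bool) :
  [/\ source k != k.1, target k != k.1 & source k != target k].
Proof. by case: k => [[[|[|[|m]]] ?] []]. Qed.

Lemma pos_apex n k b : pos k (apex n k b) = n.+4.
Proof.
have [sk tk _] := triangle_neq k; case: b => //=.
by rewrite !(eq_sym k.1) (negPf sk) (negPf tk).
Qed.

Lemma pos_node n k i : i < n.+3 -> pos k (node n k i) = i.
Proof.
move=> i_n; have [_ _ st] := triangle_neq k; rewrite /node.
have [->|i0] := eqVneq i 0; first by rewrite /= eqxx.
have [->|i1] := eqVneq i n.+2; first by rewrite /= eq_sym (negPf st) eqxx.
by rewrite /= eqxx inordK; lia.
Qed.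

Lemma node_pos n k (x : vertex n) : pos k x < n.+3 -> node n k (pos k x) = x.
Proof.
rewrite /node; case: x => [[t|]|[k' i]] /=; last 1 first.
- case: eqP => [-> _|_]; last by lia.
  by rewrite ifN ?inord_val //; have := ltn_ord i; lia.
- case: eqP => [-> //|_]; case: eqP => [-> _|_]; last by lia.
  by rewrite eqxx.
- by lia.
Qed.

Lemma pos_dichotomy n k (x : vertex n) : (pos k x < n.+3) || (pos k x == n.+4).
Proof.
case: x => [[t|]|[k' i]] /=; last by have := ltn_ord i; case: ifP; lia.
  by do 2?case: ifP; lia.
by lia.
Qed.

Lemma owner_pos n k (x : vertex n) : 0 < pos k x < n.+2 -> owner x = Some k.
Proof.
case: x => [[t|]|[k' i]] /=; first by do 2?case: ifP; lia.
  by lia.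
by case: eqP => [->//|]; lia.
Qed.

Lemma pos_owner n k k' (x : vertex n) :
  owner x = Some k' -> pos k x < n.+3 -> k' = k.
Proof. by case: x => [[t|]|[k1 i]] //= [<-]; case: eqP => //; lia. Qed.

Lemma wing_pos n k (x y z : vertex n) : wing k x y z ->
  [/\ pos k x < n.+3, pos k y < n.+3, pos k z = n.+4
    & (pos k y == (pos k x).+1) || (pos k x == (pos k y).+1)].
Proof.
have := pos_dichotomy k x; have := pos_dichotomy k y.
by rewrite /wing /step => dy dx /orP[]/andP[s /eqP->];
  rewrite pos_apex; split; lia.
Qed.

Lemma wing_apex n k (x y z : vertex n) : wing k x y z -> exists b, z = apex n k b.
Proof.
by case/orP => /andP[_ /eqP->]; [exists true | exists false].
Qed.

Lemma path_triple_ind n k (P : vertex n -> vertex n -> vertex n -> Prop) :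
  (forall x y z, P x y z -> P y z x) ->
  (forall x y z, wing k x y z -> P x y z) ->
  forall x y z, path_triple k x y z -> P x y z.
Proof. by move=> rot H x y z /or3P[/H|/H/rot/rot|/H/rot]. Qed.

Lemma path_triple_rot n k (x y z : vertex n) :
  path_triple k x y z = path_triple k y z x.
Proof. by rewrite /path_triple orbC -orbA. Qed.

Lemma path_triple_uniq n k (x y z : vertex n) :
  path_triple k x y z -> uniq [:: x; y; z].
Proof.
move: x y z; apply: path_triple_ind => x y z; first by rewrite -(rot_uniq 1).
move=> /wing_pos[px py pz xy]; apply: (map_uniq (f := pos k)).
by rewrite /= !inE; lia.
Qed.

Lemma path_triple_asym n k (x y z : vertex n) :
  path_triple k x y z -> ~~ path_triple k x z y.
Proof.
move: x y z; apply: path_triple_ind => x y z.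
  by rewrite (path_triple_rot k y).
move=> wxyz; have [px py pz _] := wing_pos wxyz.
apply/negP => /or3P[/wing_pos[]|/wing_pos[]|]; try lia.
move: wxyz; rewrite /wing /step => /orP[]/andP[+ /eqP->] /orP[]/andP[+ _] //.
- by lia.
- by lia.
Qed.

Lemma adjacent_node n k (x y : vertex n) i :
  pos k y = i.+1 -> pos k x < n.+3 ->
  (pos k x == (pos k y).+1) || (pos k y == (pos k x).+1) ->
  (x == node n k i) || (x == node n k i.+2).
Proof.
move=> -> px /orP[/eqP e|/eqP[e]].
  by rewrite -e node_pos // eqxx orbT.
by rewrite e node_pos // eqxx.
Qed.

(** A path has at least two steps, so consecutive vertices are never both endpoints. *)
Lemma path_triple_owned n k (x y z : vertex n) : path_triple k x y z ->
  exists2 w, w \in [:: x; y; z] & owner w = Some k.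
Proof.
move: x y z; apply: path_triple_ind => x y z.
  by case=> w wxyz ow; exists w; rewrite // -(mem_rot 1) in wxyz *.
move=> /wing_pos[px py pz xy].
have [x0|x0] := boolP (0 < pos k x < n.+2).
  by exists x; rewrite ?inE ?eqxx //; apply: owner_pos.
by exists y; rewrite ?inE ?eqxx ?orbT //; apply: owner_pos; lia.
Qed.

Lemma path_triple_owner n k k' (x y z w : vertex n) : path_triple k x y z ->
  w \in [:: x; y; z] -> owner w = Some k' -> k' = k.
Proof.
move: x y z; apply: path_triple_ind => x y z.
  by move=> H wyzx; apply: H; rewrite -(mem_rot 1).
move=> wxyz; have [px py _ _] := wing_pos wxyz; have [b zE] := wing_apex wxyz.
rewrite !inE => /or3P[]/eqP-> ow; [exact: pos_owner ow px|exact: pos_owner ow py|].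
by rewrite zE in ow.
Qed.

Lemma chains_partial n : partial_hypertournament (@chains n).
Proof.
have rot x y z : @chains n x y z = chains y z x.
  by apply: eq_existsb => k; apply: path_triple_rot.
split=> // [x y z /existsP[k] /path_triple_uniq //|x y z /existsP[k kxyz]].
apply/existsP => -[k' kxzy]; have [w wxyz ow] := path_triple_owned kxyz.
have wxzy : w \in [:: x; z; y] by move: wxyz; rewrite !inE [in X in _ || X]orbC.
have kE := path_triple_owner kxzy wxzy ow; rewrite -kE in kxzy.
by have := path_triple_asym kxyz; rewrite kxzy.
Qed.

(** * Irreducible substructures *)

(** A necessary condition for sharing a triple of the path k, stated through positions so that
    arithmetic can decide it. *)
Definition linked n k (x y : vertex n) :=
  [|| step k x y, step k y x, (pos k x < n.+3) && (pos k y == n.+4)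
    | (pos k y < n.+3) && (pos k x == n.+4)].

Lemma linked_step n k (x y : vertex n) :
  pos k x < n.+3 -> pos k y < n.+3 -> linked k x y -> step k x y || step k y x.
Proof.
move=> px py /or4P[->//|->|/andP[_ /eqP e]|/andP[_ /eqP e]]; rewrite ?orbT //.
  by rewrite e in py; lia.
by rewrite e in px; lia.
Qed.

Lemma path_triple_linked n k (a b c x y : vertex n) : path_triple k a b c ->
  x \in [:: a; b; c] -> y \in [:: a; b; c] -> x != y -> linked k x y.
Proof.
move: a b c; apply: path_triple_ind => a b c.
  by move=> H xbca ybca; apply: H; rewrite -(mem_rot 1).
move=> /wing_pos[pa pb pc ab]; rewrite /linked /step !inE.
by move=> /or3P[]/eqP-> /or3P[]/eqP->; rewrite ?eqxx //; lia.
Qed.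

Lemma path_triple_apex n k (a b c x : vertex n) : path_triple k a b c ->
  x \in [:: a; b; c] -> pos k x = n.+4 -> exists i, x = apex n k i.
Proof.
move: a b c; apply: path_triple_ind => a b c.
  by move=> H xbca; apply: H; rewrite -(mem_rot 1).
move=> wabc; have [pa pb _ _] := wing_pos wabc; have [i cE] := wing_apex wabc.
by rewrite !inE => /or3P[]/eqP->; [lia|lia|exists i].
Qed.

(** Since z is off the path, x and y must be on it and hence consecutive; the direction of the step
    and the kind of apex fix the orientation. *)
Lemma chains_linked n k (x y z : vertex n) i : z = apex n k i ->
  linked k x y -> linked k x z -> linked k y z -> chains x y z || chains x z y.
Proof.
move=> zE; have pz : pos k z = n.+4 by rewrite zE pos_apex.
rewrite /linked /step => xy xz yz; have {xy xz yz} : step k x y || step k y x.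
  by have := pos_dichotomy k x; have := pos_dichotomy k y; rewrite /step; lia.
have wE u v : wing k u v z = if i then step k u v else step k v u.
  by rewrite /wing zE; case: i {zE} => /=; rewrite !eqxx ?andbT ?andbF ?orbF.
have -> : chains x z y = chains y x z.
  by have [_ rot _] := chains_partial n; rewrite -rot.
by case/orP => s; case: i wE {zE} => wE; apply/orP; [left|right|right|left];
  apply/existsP; exists k; rewrite /path_triple wE s.
Qed.

(* Every triple lies on a single path, so all triples of an irreducible      *)
(* substructure lie on the same one; its vertices are then pairwise          *)
(* consecutive on that path, apart from one apex.                            *)
Lemma chains_irreducible n (U : finType) (f : U -> vertex n) :
  injective f -> irreducible (fun x y z => chains (f x) (f y) (f z)) ->
  hypertournament (fun x y z => chains (f x) (f y) (f z)).
Proof.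
move=> fI irr; have [nd rot asym] := chains_partial n.
apply: partial_hypertournament_total => [|x y z].
  split=> // x y z; last exact: asym.
  by move=> /nd; rewrite -[[:: f x; f y; f z]]/(map f [:: x; y; z]) map_inj_uniq.
rewrite /= !inE negb_or => /and3P[/andP[xy xz] yz _].
have [a [b [c [/existsP[k kabc] _ _]]]] := irr x y xy.
(* Inner vertices of two triples share a third triple by irreducibility, so all three lie on one
   path. *)
have only_k a' b' c' : chains (f a') (f b') (f c') ->
    path_triple k (f a') (f b') (f c').
  move=> /existsP[k' kabc'].
  have [w] := path_triple_owned kabc.
  rewrite -[[:: f a; f b; f c]]/(map f [:: a; b; c]) => /mapP[p pabc ->] op.
  have [w'] := path_triple_owned kabc'.
  rewrite -[[:: f a'; _; _]]/(map f [:: a'; b'; c']) => /mapP[q qabc ->] oq.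
  suff -> : k = k' by [].
  have [pq|pq] := eqVneq p q; first by move: oq; rewrite -pq op => -[].
  have [a2 [b2 [c2 [/existsP[k2 kabc2] p2 q2]]]] := irr p q pq.
  rewrite (path_triple_owner kabc2 (map_f f p2) op).
  by rewrite (path_triple_owner kabc2 (map_f f q2) oq).
have link p q : p != q -> linked k (f p) (f q).
  move=> pq; have [a2 [b2 [c2 [/only_k kabc2 p2 q2]]]] := irr p q pq.
  apply: (path_triple_linked kabc2 (map_f f p2) (map_f f q2)).
  by rewrite (inj_eq fI).
have isapex p q : p != q -> pos k (f p) = n.+4 -> exists i, f p = apex n k i.
  move=> pq; have [a2 [b2 [c2 [/only_k kabc2 p2 q2]]]] := irr p q pq.
  exact: (path_triple_apex kabc2 (map_f f p2)).
have lxy := link _ _ xy; have lxz := link _ _ xz; have lyz := link _ _ yz.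
have [yx zx zy] : [/\ y != x, z != x & z != y].
  by rewrite !(eq_sym z) (eq_sym y).
have lyx := link _ _ yx; have lzx := link _ _ zx; have lzy := link _ _ zy.
have /orP[px|/eqP px] := pos_dichotomy k (f x); last first.
  have [i xE] := isapex x y xy px.
  by have := chains_linked xE lyz lyx lzx; rewrite -(rot (f x)) (rot (f y) (f x)).
have /orP[py|/eqP py] := pos_dichotomy k (f y); last first.
  have [i yE] := isapex y x yx py.
  by have := chains_linked yE lzx lzy lxy; rewrite (rot (f z) (f x)) -(rot (f x) (f z)).
have /orP[pz|/eqP pz] := pos_dichotomy k (f z); last first.
  have [i zE] := isapex z x zx pz.
  exact: chains_linked zE lxy lxz lyz.
(* Three positions on a path cannot be pairwise consecutive. *)
move: (linked_step px py lxy) (linked_step px pz lxz) (linked_step py pz lyz).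
by rewrite /step; clear; lia.
Qed.

(** * No completion *)

Lemma completion_step n (R' : ternary (vertex n)) k x y :
  completion (@chains n) R' -> step k x y ->
  R' (apex n k true) (apex n k false) x -> R' (apex n k true) (apex n k false) y.
Proof.
move=> [extR' htR' freeR'] sxy Rx.
have [_ rot' _] := hypertournament_partial htR'.
set a := apex n k true in Rx *; set c := apex n k false in Rx *.
have xya : R' x y a.
  by apply/extR'/existsP; exists k; rewrite /path_triple /wing sxy eqxx.
have yxc : R' y x c.
  by apply/extR'/existsP; exists k; rewrite /path_triple /wing sxy eqxx orbT.
(* Three of the four triples of this quadruple hold, so (a,y,c) fails. *)
have := H4_free_incoherent a c x y htR' freeR'.
rewrite /coherent Rx (rot' a x) xya (rot' c y) yxc /= andbT => Rayc.
have uacy : uniq [:: a; c; y].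
  have dx := pos_dichotomy k x; have dy := pos_dichotomy k y.
  have yE b : apex n k b != y.
    apply: contraTneq sxy => <-; rewrite /step pos_apex; lia.
  by rewrite /= !inE negb_or !yE.
by rewrite -[R' a c y]negbK -(hypertournament_xor htR' uacy).
Qed.

Lemma completion_path n (R' : ternary (vertex n)) k :
  completion (@chains n) R' ->
  R' (inl (Some k.1)) (inl None) (inl (Some (source k))) ->
  R' (inl (Some k.1)) (inl None) (inl (Some (target k))).
Proof.
move=> cR' H0.
have -> : inl (Some (target k)) = node n k n.+2 by rewrite /node eqxx.
have : n.+2 < n.+3 by []; elim: {1 3}n.+2 => [|i IHi] lti.
  by rewrite /node.
apply: (completion_step (k := k) cR' _ (IHi (ltnW lti))).
by rewrite /step !pos_node // ltnW.
Qed.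

Lemma chains_incompletable n : ~ has_completion (@chains n).
Proof.
move=> [R' cR']; have [_ htR' _] := cR'.
have [_ rot' _] := hypertournament_partial htR'.
(* [F s t] says that s beats t. Each vertex is beaten by both others or by neither, but a tournament
   on three vertices has three arcs, an odd number. *)
pose F (s t : 'I_3) := R' (inl (Some t)) (inl None) (inl (Some s)).
have Fsym t : F (ordS t) t = F (ord_pred t) t.
  by apply/idP/idP; [exact: (completion_path (k := (t, true)) cR')
                    |exact: (completion_path (k := (t, false)) cR')].
have Fanti s t : s != t -> F t s = ~~ F s t.
  move=> st; rewrite /F (rot' (inl (Some s))) (rot' (inl None)).
  rewrite (hypertournament_xor htR') //= !inE andbT.
  by apply: contraNneq st => -[->].
pose o1 : 'I_3 := ordS ord0; pose o2 : 'I_3 := ordS o1.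
have := Fsym ord0; have := Fsym o1; have := Fsym o2.
have -> : ord_pred ord0 = o2 by apply: val_inj.
have -> : ordS o2 = ord0 by apply: val_inj.
rewrite !ordSK -/o1 -/o2 (Fanti ord0 o1) // (Fanti ord0 o2) // (Fanti o1 o2) //.
by do 3 case: (F _ _).
Qed.

(** * Completing small substructures *)

(** A path with an inner vertex in A also misses one of its n + 1 inner vertices, so some inner v in
    A has a path neighbour w outside A. Every triple of v inside A then uses its other neighbour u,
    which may be an endpoint and need not lie in A. *)
Lemma chains_peelable n (A : {set vertex n}) : #|A| <= n -> A != set0 ->
  exists u v, [/\ v \in A, u != v & forall x y, x \in A -> y \in A ->
    chains v x y -> (x == u) || (y == u)].
Proof.
move=> cA /set0Pn[v0 Av0].
have [/existsP[p Ap]|noinner] := boolP [exists p, inr p \in A]; last first.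
  (* Without inner vertices A carries no triple, so any u distinct from v will do. *)
  exists (if v0 == inl None then inl (Some ord0) else inl None), v0.
  split=> // [|x y Ax Ay /existsP[k]].
    by case: ifP => [/eqP-> //|/negbT]; rewrite eq_sym.
  move=> /path_triple_owned[w wvxy].
  have Aw : w \in A.
    by move: wvxy; rewrite !inE => /or3P[]/eqP->.
  case: w {wvxy} Aw => // q Aq _.
  by case/existsP: noinner; exists q.
pose k := p.1; pose P i := node n k i.+1 \in A.
have [/existsP[m Pm]|const] := boolP [exists m : 'I_n, P m != P m.+1].
  have [u [v [w [Av Aw uv inner_v nbr_v]]]] : exists u v w : vertex n,
      [/\ v \in A, w \notin A, u != v, 0 < pos k v < n.+2 &
        forall x, pos k x < n.+3 ->
          (pos k x == (pos k v).+1) || (pos k v == (pos k x).+1) ->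
          (x == u) || (x == w)].
    have lt_mn := ltn_ord m.
    have node_neq i : i < n.+2 -> node n k i != node n k i.+1.
      move=> lti; apply/eqP=> /(congr1 (pos k)).
      by rewrite !pos_node // 1?ltnW // => /eqP; rewrite ltn_eqF.
    have [lt1 lt2] : m.+1 < n.+3 /\ m.+2 < n.+3 by rewrite !ltnS ltnW // ltnW.
    have p1 : pos k (node n k m.+1) = m.+1 by apply: pos_node.
    have p2 : pos k (node n k m.+2) = m.+2 by apply: pos_node.
    move: Pm; rewrite /P.
    case: (boolP (_ m.+1 \in A)) => A1; case: (boolP (_ m.+2 \in A)) => A2;
      rewrite ?eqxx // => _.
      exists (node n k m), (node n k m.+1), (node n k m.+2); split=> //.
      - exact/node_neq/ltnW.
      - by rewrite p1 /= !ltnS ltnW.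
      - by move=> x px; apply: adjacent_node.
    exists (node n k m.+3), (node n k m.+2), (node n k m.+1); split=> //.
    - by rewrite eq_sym node_neq.
    - by rewrite p2.
    - by move=> x px xy; rewrite orbC; apply: adjacent_node p2 px xy.
  exists u, v; split=> // x y Ax Ay /existsP[k' kvxy].
  have kE : k = k'.
    by apply: path_triple_owner kvxy (mem_head _ _) (owner_pos inner_v).
  have notw z : z \in A -> (z == w) = false by apply: contraTF => /eqP->.
  rewrite -kE in kvxy; case/or3P: kvxy => /wing_pos[].
  - by move=> _ lt _ /(nbr_v _ lt); rewrite (notw x) // orbF => ->.
  - by move=> _ _ e _; move: inner_v; rewrite e; clear; lia.
  - move=> lt _ _; rewrite orbC => /(nbr_v _ lt).
    by rewrite (notw y) // orbF => ->; rewrite orbT.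
(* Otherwise membership is constant along the path, and A contains all n + 1 inner vertices. *)
have Pconst i : i <= n -> P i = P 0.
  elim: i => // i IHi lti; apply: etrans (IHi (ltnW lti)); apply/esym/eqP.
  by apply: contraNT const => Pi; apply/existsP; exists (Ordinal lti).
have pE : inr p = node n k p.2.+1.
  have pp : pos k (inr p : vertex n) = p.2.+1 by rewrite /= eqxx.
  by rewrite -pp node_pos // pp ltnS ltnW // ltnS.
have P0 : P 0.
  have le_p : p.2 <= n by rewrite -ltnS.
  by have := Pconst _ le_p; rewrite {1}/P -pE Ap => <-.
have : #|[set node n k i.+1 | i : 'I_n.+1]| <= #|A|.
  apply/subset_leq_card/subsetP=> x /imsetP[i _ ->].
  have le_i : i <= n by rewrite -ltnS.
  by have := Pconst _ le_i; rewrite {1}/P P0.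
rewrite card_imset ?card_ord => [|i j /(congr1 (pos k))]; first by move: cA; clear; lia.
by rewrite !pos_node ?ltnS ?ltn_ord 1?ltnW ?ltn_ord // => -[/val_inj].
Qed.

Lemma chains_small n (S : {set vertex n}) :
  #|S| <= n -> has_completion (substructure (@chains n) S).
Proof.
move=> cS; apply: peelable_completion => [|A AS A0]; first exact: chains_partial.
exact: chains_peelable (leq_trans (subset_leq_card AS) cS) A0.
Qed.

(** * A smallest non-completable substructure *)

(** Minimality is by cardinality, which is easily compared once subsets of a subtype are flattened
    to subsets of [T]. *)
Lemma minimal_incompletable (T : finType) (R : ternary T) :
  ~ has_completion R ->
  exists2 S : {set T}, ~ has_completion (substructure R S) &
    forall S' : {set T}, #|S'| < #|S| -> has_completion (substructure R S').
Proof.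
move=> ncR; have : ~ has_completion (substructure R [set: T]).
  move=> cT; apply: ncR.
  have fI : injective (fun x : T => exist (fun x => x \in [set: T]) x (in_setT x)).
    by move=> x y [].
  exact: (completion_pullback fI cT).
move: [set: T] => S; have [m] := ubnP #|S|; elim: m S => // m IHm S cS ncS.
have [[S' [cS' ncS']]|none] := classic (exists S' : {set T},
    #|S'| < #|S| /\ ~ has_completion (substructure R S')).
  by apply: IHm ncS'; apply: leq_trans cS' _.
exists S => // S' cS'; apply: NNPP => ncS'.
by apply: none; exists S'.
Qed.

Theorem theorem2 (n : nat) :
  exists (B : finType) (R : ternary B),
    [/\ n <= #|B|,
        holey_hypertournament R,
        ~ has_completion R
      & forall S : {set B}, S \proper [set: B] ->
          has_completion (substructure R S)].
Proof.
have [S0 ncS0 minS0] := minimal_incompletable (@chains_incompletable n).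
exists {x | x \in S0}, (substructure (@chains n) S0).
have cardS0 : #|[set: {x | x \in S0}]| = #|S0| by rewrite cardsT card_sig.
split=> //.
- by rewrite card_sig leqNgt; apply/negP=> /ltnW/chains_small.
- move=> S; apply: (chains_irreducible (f := fun x => val (val x))).
  exact: inj_comp val_inj val_inj.
move=> S /proper_card; rewrite cardS0 => cS.
pose S' := [set val x | x in S].
have S'P (x : {x | x \in S}) : val (val x) \in S' by apply: imset_f (valP x).
have cS' : has_completion (substructure (@chains n) S').
  by apply: minS0; rewrite card_imset //; apply: val_inj.
have fI : injective (fun x => exist (fun y => y \in S') _ (S'P x)).
  by move=> x y [/val_inj/val_inj].
exact: (completion_pullback fI cS').
Qed.
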